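(* Let $T\colon X\to X$ be a homeomorphism of a compact metric space $X$. Let $f,g\colon X\to(0,1]$ and $\phi\colon X\to\mathbb{R}$ be continuous, and suppose that $\beta(\log f)=\beta(\log g)=0$. For $x\in X$ define \[A(x):=\begin{pmatrix}f(x)&\phi(x)\\0&g(x)\end{pmatrix}\in\mathrm{GL}_2(\mathbb{R}).\] If $\mathcal{M}_{\max}(\log f)\cap\mathcal{M}_{\max}(\log g)\neq\emptyset$ then \[\lim_{n\to\infty}\frac1n\sup_{x\in X}\|A(T^{n-1}x)\cdots A(x)\|=\sup_{\mu\in\mathcal{M}_{\max}(\log f)\cap\mathcal{M}_{\max}(\log g)}\left|\int\phi\,d\mu\right|,\] and if $\mathcal{M}_{\max}(\log f)\cap\mathcal{M}_{\max}(\log g)=\emptyset$ then \[\lim_{n\to\infty}\frac1n\sup_{x\in X}\|A(T^{n-1}x)\cdots A(x)\|=0.\] (In particular these limits exist.)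
   Context: $\|\cdot\|$ is the Euclidean operator norm. $\mathcal{M}_T(X)$ denotes the set of $T$-invariant Borel probability measures on $X$. For continuous $\psi\colon X\to\mathbb{R}$, $\beta(\psi):=\sup_{\mu\in\mathcal{M}_T(X)}\int\psi\,d\mu$, and $\mathcal{M}_{\max}(\psi):=\{\mu\in\mathcal{M}_T(X)\colon\int\psi\,d\mu=\beta(\psi)\}$. *)

(* Defs.v *)
From HB Require Import structures.
From mathcomp Require Import all_boot all_order all_algebra.
From mathcomp Require Import all_classical all_reals all_analysis.
Set Implicit Arguments. Unset Strict Implicit. Unset Printing Implicit Defensive.
Import Order.TTheory GRing.Theory Num.Theory.
Import numFieldNormedType.Exports.
Local Open Scope classical_set_scope.
Local Open Scope ring_scope.

Notation Borel X := (g_sigma_algebraType (@open X)).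

#[short(type="pmetricType")]
HB.structure Definition PMetric (K : numDomainType) :=
  { M of Pointed M & Metric K M }.

Section Defs.
Context {R : realType} {X : pmetricType R}.

Definition homeomorphism (T : X -> X) : Prop :=
  continuous T /\ exists Tinv : X -> X,
    [/\ continuous Tinv, cancel T Tinv & cancel Tinv T].

Definition invariant_measures (T : X -> X) : set (probability (Borel X) R) :=
  [set mu | forall A : set (Borel X), measurable A -> mu (T @^-1` A) = mu A].

Definition integ (mu : probability (Borel X) R) (psi : X -> R) : R :=
  Rintegral mu [set: Borel X] psi.

Definition beta (T : X -> X) (psi : X -> R) : R :=
  sup [set integ mu psi | mu in invariant_measures T].

Definition Mmax (T : X -> X) (psi : X -> R) : set (probability (Borel X) R) :=
  [set mu | invariant_measures T mu /\ integ mu psi = beta T psi].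

Definition opnorm2 (M : 'M[R]_2) : R :=
  sup [set Num.sqrt (\sum_(i < 2) ((M *m v) i 0) ^+ 2) |
        v in [set v : 'cV[R]_2 | \sum_(i < 2) (v i 0) ^+ 2 = 1]].

Definition Amat (f g phi : X -> R) (x : X) : 'M[R]_2 :=
  \matrix_(i < 2, j < 2)
    if (i == 0 :> nat) then (if (j == 0 :> nat) then f x else phi x)
    else (if (j == 0 :> nat) then 0 else g x).

Fixpoint cocycle (A : X -> 'M[R]_2) (T : X -> X) (n : nat) (x : X) : 'M[R]_2 :=
  match n with
  | 0 => 1%:M
  | k.+1 => A (iter k T x) *m cocycle A T k x
  end.

End Defs.

(* Main.v *)
Require Import Defs.
From HB Require Import structures.
From mathcomp Require Import all_boot all_order all_algebra.
From mathcomp Require Import all_classical all_reals all_analysis.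
From mathcomp Require Import measurable_realfun ring lra.
Import Order.TTheory GRing.Theory Num.Theory.
Import numFieldNormedType.Exports.
Local Open Scope classical_set_scope.
Local Open Scope ring_scope.

(** The product A(T^(n-1) x) ... A(x) is upper triangular with diagonal entries
    in (0,1], so up to a bounded error its norm is the modulus of the corner entry
    [sum_(k<n) w_k phi(T^k x)], with weights
    [w_k = f(T^(n-1) x) ... f(T^(k+1) x) g(T^(k-1) x) ... g(x)].

    Lower bound: an invariant measure with [int ln f = int ln g = 0] satisfies
    [int (1-f) = int (1-g) = 0], hence sees only weights equal to 1, and the
    integral of the corner entry is [n * int phi].

    Upper bound: [w] is the product of a nondecreasing and a nonincreasing sequence
    in [0,1], so it has variation at most 2, and both [sum_k w_k (1 - f(T^k x))] and
    [sum_k w_k (1 - g(T^k x))] telescope to at most 1.  Therefore every ultrafilter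
    limit of the functionals [psi |-> 1/n sum_k w_k psi(T^k x_n)] is T-invariant and
    kills [1-f] and [1-g]; unless it is zero, its normalisation is integration
    against a measure maximising both ln f and ln g, by the Riesz representation
    theorem on a compact metric space. *)

(** * Integration of continuous functions *)

Section integ_continuous.
Context {R : realType} {X : pmetricType R}.
Hypothesis cX : compact [set: X].
Implicit Types (a b psi : X -> R) (mu : probability (Borel X) R).

Lemma continuous_fun_bounded psi : continuous psi ->
  exists2 M, 0 < M & forall x, `|psi x| <= M.
Proof.
move=> cpsi.
have : compact (psi @` [set: X]).
  by apply: continuous_compact => //; apply: continuous_subspaceT.
move/compact_bounded => [M [_ hM]].
exists (`|M| + 1); first by rewrite ltr_wpDl.
move=> x; apply: hM; last by exists x.
by rewrite (le_lt_trans (ler_norm _))// ltrDl.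
Qed.

Lemma continuous_measurable psi : continuous psi ->
  measurable_fun [set: Borel X] (psi : Borel X -> R).
Proof.
move=> cpsi; apply: (measurability _ (RGenOpens.measurableE R)) => //.
move=> _ [_ [a [b ->] <-]]; rewrite setTI.
apply: sub_gen_smallest; move/continuousP: cpsi; apply.
exact: itv_open.
Qed.

Lemma continuous_measurable_map (T : X -> X) : continuous T ->
  measurable_fun [set: Borel X] (T : Borel X -> Borel X).
Proof.
move=> cT; apply: (@measurability _ _ (Borel X) (Borel X) setT T (@open X)) => //.
move=> _ [A oA <-]; rewrite setTI; apply: sub_gen_smallest.
by move/continuousP: cT; apply.
Qed.

Lemma continuous_integrable mu psi : continuous psi ->
  mu.-integrable [set: Borel X] (EFin \o psi).
Proof.
move=> cpsi; have [M M0 hM] := continuous_fun_bounded _ cpsi.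
apply: measurable_bounded_integrable => //.
- by rewrite [X in (X < _)%E](probability_setT mu) ltry.
- exact: continuous_measurable.
- exists M; split; first exact: num_real.
  by move=> y My x _ /=; rewrite (le_trans (hM x))// ltW.
Qed.

Lemma integD mu a b : continuous a -> continuous b ->
  integ mu (fun x => a x + b x) = integ mu a + integ mu b.
Proof. by move=> ca cb; rewrite /integ RintegralD//; exact: continuous_integrable. Qed.

Lemma integZ mu r a : continuous a ->
  integ mu (fun x => r * a x) = r * integ mu a.
Proof. by move=> ca; rewrite /integ RintegralZl//; exact: continuous_integrable. Qed.

Lemma integ_cst mu r : integ mu (fun=> r) = r.
Proof. by rewrite /integ Rintegral_cst// [X in fine X](probability_setT mu) mulr1. Qed.

Lemma le_integ mu a b : continuous a -> continuous b ->
  (forall x, a x <= b x) -> integ mu a <= integ mu b.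
Proof.
by move=> ca cb ab; apply: le_Rintegral => //; exact: continuous_integrable.
Qed.

Lemma continuous_sum (I : Type) (r : seq I) (F : I -> X -> R) :
  (forall i, continuous (F i)) -> continuous (fun x => \sum_(i <- r) F i x).
Proof.
move=> cF; elim: r => [|i r IH].
  by under eq_fun do rewrite big_nil; exact: cst_continuous.
under eq_fun do rewrite big_cons.
by move=> x; apply: cvgD; [exact: cF|exact: IH].
Qed.

Lemma integ_sum mu (n : nat) (F : nat -> X -> R) :
  (forall i, continuous (F i)) ->
  integ mu (fun x => \sum_(i < n) F i x) = \sum_(i < n) integ mu (F i).
Proof.
move=> cF; elim: n => [|n IH].
  by under eq_fun do rewrite big_ord0; rewrite big_ord0 integ_cst.
under eq_fun do rewrite big_ord_recr/=.
by rewrite integD ?IH ?big_ord_recr//; exact: continuous_sum.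
Qed.

Lemma integ_invariant mu (T : X -> X) psi : invariant_measures T mu ->
  continuous T -> continuous psi -> integ mu (psi \o T) = integ mu psi.
Proof.
move=> imu cT cpsi.
have mT := continuous_measurable_map _ cT.
rewrite /integ /Rintegral; congr fine.
rewrite [RHS](eq_measure_integral (pushforward mu (T : Borel X -> Borel X))); last first.
  by move=> A mA _; rewrite /pushforward; exact/esym/imu.
rewrite integral_pushforward//.
- by apply/measurable_EFinP; exact: continuous_measurable.
- apply: (@continuous_integrable mu (psi \o T)).
  by move=> x; apply: continuous_comp; [exact: cT|exact: cpsi].
Qed.

Lemma continuous_ln_comp (h : X -> R) : continuous h -> (forall x, 0 < h x) ->
  continuous (fun x => ln (h x)).
Proof.
move=> ch h0 x; apply: (@continuous_comp _ _ _ h (@ln R)); first exact: ch.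
exact: continuous_ln.
Qed.

(** Integrates [0 <= 1 - h <= - ln h], which is [ln t <= t - 1] at [t = h x]. *)
Lemma integ_one_sub_eq0 mu (h : X -> R) : continuous h ->
  (forall x, 0 < h x <= 1) -> integ mu (fun x => ln (h x)) = 0 ->
  integ mu (fun x => 1 - h x) = 0.
Proof.
move=> ch h01 lnh.
have h0 x : 0 < h x by case/andP: (h01 x).
have clnh := continuous_ln_comp _ ch h0.
have c1h : continuous (fun x => 1 - h x).
  by move=> x; apply: cvgB; [exact: cvg_cst|exact: ch].
apply/eqP; rewrite eq_le; apply/andP; split; last first.
  by apply: Rintegral_ge0 => x _; rewrite subr_ge0; case/andP: (h01 x).
rewrite -(mulr0 (-1)) -lnh -integZ//; apply: le_integ => //.
  by move=> x; apply: cvgM; [exact: cvg_cst|exact: clnh].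
move=> x; rewrite mulN1r -lerN2 opprK opprB.
by rewrite -{1}(subrK 1 (h x)) addrC le_ln1Dx// ltrBrDl subrr.
Qed.

(** Converse of the previous lemma: [- ln h = ln (1/h) <= 1/h - 1 = (1 - h)/h <= M * (1 - h)], where
    compactness bounds [1/h] by [M]. *)
Lemma integ_ln_eq0 mu (h : X -> R) : continuous h ->
  (forall x, 0 < h x <= 1) -> integ mu (fun x => 1 - h x) = 0 ->
  integ mu (fun x => ln (h x)) = 0.
Proof.
move=> ch h01 ih.
have h0 x : 0 < h x by case/andP: (h01 x).
have clnh := continuous_ln_comp _ ch h0.
have c1h : continuous (fun x => 1 - h x).
  by move=> x; apply: cvgB; [exact: cvg_cst|exact: ch].
have [M M0 hM] : exists2 M, 0 < M & forall x, `|(h x)^-1| <= M.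
  apply: continuous_fun_bounded => // x; apply: cvgV; last exact: ch.
  by rewrite gt_eqF.
apply/eqP; rewrite eq_le; apply/andP; split.
  rewrite -(integ_cst mu 0); apply: le_integ => //; first exact: cst_continuous.
  by move=> x; rewrite ln_le0//; case/andP: (h01 x).
rewrite -(mulr0 (- M)) -ih -integZ//; apply: le_integ => //.
  by move=> x; apply: cvgM; [exact: cvg_cst|exact: c1h].
move=> x; rewrite mulNr lerNl -lnV ?posrE//.
have h1 : ln (h x)^-1 <= (h x)^-1 - 1.
  by rewrite -{1}(subrK 1 (h x)^-1) addrC le_ln1Dx// ltrBrDl subrr invr_gt0.
apply: (le_trans h1).
have -> : (h x)^-1 - 1 = (h x)^-1 * (1 - h x).
  by rewrite mulrBr mulr1 mulVf// gt_eqF.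
rewrite ler_wpM2r//; first by rewrite subr_ge0; case/andP: (h01 x).
exact: le_trans (ler_norm _) (hM x).
Qed.

End integ_continuous.

(** One enumeration [e] serves every [F]: [riesz_outer_le_double] uses it both for the values
    [psi i j x] and for the costs [L (psi i j)]. *)
Lemma nneseries_pair : exists e : nat -> nat * nat,
  forall (R : realType) (F : nat -> nat -> \bar R),
    (forall i j, 0 <= F i j)%E ->
    (\sum_(k <oo) F (e k).1 (e k).2 = \sum_(i <oo) \sum_(j <oo) F i j)%E.
Proof.
have /card_esym/ppcard_eqP[e] := card_nat2; exists e => R F F0.
rewrite nneseries_esumT// [RHS]nneseries_esumT; last first.
  by move=> i; exact: nneseries_ge0.
under [RHS]eq_esum do rewrite nneseries_esumT//.
rewrite esum_esum// (reindex_esum setT _ e)//.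
have -> : [set: nat] `*`` (fun=> [set: nat]) = [set: nat * nat].
  by apply/seteqP; split.
exact: 'bij_e.
Qed.

(** * Continuous functions and open sets in a metric space *)

Section metric_functions.
Context {R : realType} {X : pmetricType R}.

(** The function is the distance to the complement of [U], positive on [U] because a ball fits
    inside. An empty complement is treated apart, since the infimum of the empty set is 0 by
    convention. *)
Lemma open_positivity_set (U : set X) : open U ->
  exists h : X -> R,
    [/\ continuous h, forall x, 0 <= h x & forall x, U x <-> 0 < h x].
Proof.
move=> oU; have [UT|/eqP/set0P [c0 Uc0]] := pselect (~` U = set0).
  exists (fun=> 1); split => //; first exact: cst_continuous.
  move=> x; split => // _; apply: contrapT => Ux.
  by have : (~` U) x by []; rewrite UT.
pose D x := [set mdist x c | c in ~` U].
have hD x : has_inf (D x).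
  split; first by exists (mdist x c0), c0.
  by exists 0 => _ [c _ <-]; exact: mdist_ge0.
have hle x c : ~ U c -> inf (D x) <= mdist x c.
  by move=> Uc; apply: ge_inf; [case: (hD x)|exists c].
have hge x (r : R) : (forall c, ~ U c -> r <= mdist x c) -> r <= inf (D x).
  by move=> H; apply: lb_le_inf; [case: (hD x)|move=> _ [c Uc <-]; exact: H].
have lip x y : inf (D x) - mdist x y <= inf (D y).
  apply: hge => c Uc; rewrite lerBlDr addrC.
  exact: le_trans (hle x c Uc) (metric_triangle _ _ _).
exists (fun x => inf (D x)); split.
- move=> x; apply/cvgrPdist_lt => e e0.
  apply/nbhs_ballP; exists e => //= y xy.
  have {}xy : mdist x y < e by move: xy; rewrite ballEmdist.
  have l1 := lip x y; have l2 := lip y x; move: l2; rewrite (metric_sym y x) => l2.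
  by rewrite ltr_norml; apply/andP; split; lra.
- by move=> x; apply: hge => c _; exact: mdist_ge0.
- move=> x; split => [Ux|h0].
    move: oU; rewrite openE => /(_ x Ux); rewrite /interior -nbhs_ballE => -[e /= e0 he].
    apply: (lt_le_trans e0); apply: hge => c Uc; rewrite leNgt; apply/negP => xc.
    by apply: Uc; apply: he; rewrite ballEmdist.
  apply: contrapT => Ux; move: h0; apply/negP; rewrite -leNgt.
  by rewrite (le_trans (hle x x Ux))// mdistxx.
Qed.

Lemma min_cst_continuous (a : X -> R) (r : R) : continuous a ->
  continuous (fun x => Num.min (a x) r).
Proof.
by move=> ca x; apply: continuous_min; [exact: ca|exact: cst_continuous].
Qed.

(** Dini's argument: were there points [p n] with [s n (p n) <= r], then some [s n] would exceed [r]
    near a cluster point of [p], hence so would every later [s m], contradicting the choice of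
    [p m]. *)
Lemma monotone_compact_cover (s : nat -> X -> R) (r : R) :
  compact [set: X] -> (forall n, continuous (s n)) ->
  (forall x, {homo s ^~ x : m n / (m <= n)%N >-> m <= n}) ->
  (forall x, exists n, r < s n x) -> exists n, forall x, r < s n x.
Proof.
move=> cX cs ms hs; apply: contrapT => H.
have {}H n : exists x, s n x <= r.
  apply: contrapT => Hn; apply: H; exists n => x; rewrite ltNge; apply/negP => ?.
  by apply: Hn; exists x.
have [p hp] := choice H.
have [x [_ clx]] : [set: X] `&` cluster (p @ \oo) !=set0 by apply: cX; exact: filterT.
have [n rn] := hs x.
have nx : nbhs x [set y | r < s n y].
  exact: (cvgr_gt _ (cs n x) _ rn).
have pn : (p @ \oo) [set p m | m in [set m | (n <= m)%N]].
  by exists n => // m nm; exists m.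
have [y [/= [m nm <-]]] := clx _ _ pn nx.
by rewrite ltNge => /negP; apply; exact: le_trans (ms _ _ _ nm) (hp m).
Qed.

End metric_functions.

(** * Riesz representation on a compact metric space *)

Section riesz.
Context {R : realType} {X : pmetricType R}.
Implicit Types (a b : X -> R) (r : R).
Variable L : (X -> R) -> R.

(** A cover dominates the indicator of [A] by a series, and [riesz_outer] is the least total cost
    under [L], as in Daniell's construction. Countable families, rather than single functions, can
    be merged, whence countable subadditivity. *)
Definition riesz_cover (A : set X) : set (nat -> X -> R) :=
  [set psi : nat -> X -> R | [/\ forall i, continuous (psi i), forall i x, 0 <= psi i x &
    forall x, A x -> (1 <= \sum_(i <oo) (psi i x)%:E)%E]].

Definition riesz_outer (A : set X) : \bar R :=
  ereal_inf [set (\sum_(i <oo) (L (psi i))%:E)%E | psi in riesz_cover A].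

Hypothesis cX : compact [set: X].
Hypothesis LD : forall a b, continuous a -> continuous b ->
  L (fun x => a x + b x) = L a + L b.
Hypothesis LZ : forall r a, continuous a -> L (fun x => r * a x) = r * L a.
Hypothesis L_ge0 : forall a, continuous a -> (forall x, 0 <= a x) -> 0 <= L a.
Hypothesis L1 : L (fun=> 1) = 1.

Lemma functional0 : L (fun=> 0) = 0.
Proof.
rewrite -[RHS](mul0r (L (fun=> 1))) -(LZ 0 _ (@cst_continuous X R 1)).
by congr L; apply/funext => x; rewrite mul0r.
Qed.

Lemma le_functional a b : continuous a -> continuous b ->
  (forall x, a x <= b x) -> L a <= L b.
Proof.
move=> ca cb ab.
have cba : continuous (fun x => b x - a x).
  by move=> x; apply: cvgB; [exact: cb|exact: ca].
have -> : b = (fun x => a x + (b x - a x)) by apply/funext => x; rewrite addrC subrK.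
by rewrite LD// lerDl L_ge0// => x; rewrite subr_ge0.
Qed.

Lemma functional_sum (n : nat) (F : nat -> X -> R) :
  (forall i, continuous (F i)) ->
  L (fun x => \sum_(0 <= i < n) F i x) = \sum_(0 <= i < n) L (F i).
Proof.
move=> cF; elim: n => [|n IH].
  by under eq_fun do rewrite big_nil; rewrite big_nil functional0.
under eq_fun do rewrite big_nat_recr//=.
by rewrite LD ?IH ?big_nat_recr//; exact: continuous_sum.
Qed.

Lemma riesz_outer_ge0 A : (0 <= riesz_outer A)%E.
Proof.
apply: le_ereal_inf_tmp => _ [psi [cpsi psi0 _] <-].
by apply: nneseries_ge0 => i _ _; rewrite lee_fin L_ge0.
Qed.

Lemma le_riesz_outer : {homo riesz_outer : A B / A `<=` B >-> (A <= B)%E}.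
Proof.
move=> A B AB; apply/ereal_inf_le_tmp => _ [psi [? ? h] <-].
by exists psi => //; split => // x /AB; exact: h.
Qed.

(** The cover is [a] followed by zero functions. *)
Lemma riesz_outer_le (A : set X) (a : X -> R) : continuous a ->
  (forall x, 0 <= a x) -> (forall x, A x -> 1 <= a x) ->
  (riesz_outer A <= (L a)%:E)%E.
Proof.
move=> ca a0 a1.
have single (u : nat -> R) : (forall i, u i.+1 = 0) -> 0 <= u 0%N ->
    (\sum_(i <oo) (u i)%:E = (u 0%N)%:E)%E.
  move=> u0 u00; rewrite nneseries_recl//; last first.
    by case=> [|i] _; rewrite lee_fin ?u0.
  by rewrite eseries0 ?adde0// => -[//|i] _ _; rewrite u0.
pose psi i := if i is 0%N then a else (fun=> 0 : R).
apply: ereal_inf_lbound; exists psi; first split.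
- by case => [|i] //=; exact: cst_continuous.
- by case.
- by move=> x Ax; rewrite (single (psi ^~ x))//= lee_fin a1.
- rewrite (single (fun i => L (psi i)))//=; last exact: L_ge0.
  by move=> i; exact: functional0.
Qed.

Lemma riesz_outer_le1 A : (riesz_outer A <= 1)%E.
Proof. by rewrite -L1; apply: riesz_outer_le => //; exact: cst_continuous. Qed.

Lemma riesz_outer_fin A : riesz_outer A \is a fin_num.
Proof.
rewrite ge0_fin_numE ?riesz_outer_ge0//.
by rewrite (le_lt_trans (riesz_outer_le1 A))// ltry.
Qed.

Lemma riesz_outer0 : riesz_outer set0 = 0%E.
Proof.
apply/eqP; rewrite eq_le riesz_outer_ge0 andbT.
have := @riesz_outer_le set0 (fun=> 0) (@cst_continuous X R 0).
by rewrite functional0; apply.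
Qed.

Lemma riesz_outer_le_double (A : set X) (psi : nat -> nat -> X -> R) :
  (forall i j, continuous (psi i j)) -> (forall i j x, 0 <= psi i j x) ->
  (forall x, A x -> (1 <= \sum_(i <oo) \sum_(j <oo) (psi i j x)%:E)%E) ->
  (riesz_outer A <= \sum_(i <oo) \sum_(j <oo) (L (psi i j))%:E)%E.
Proof.
move=> cpsi psi0 h; have [e he] := nneseries_pair.
rewrite -he; last by move=> i j; rewrite lee_fin L_ge0.
apply: ereal_inf_lbound; exists (fun k => psi (e k).1 (e k).2) => //; split => //.
move=> x /h; rewrite -(he _ (fun i j => (psi i j x)%:E))// => i j.
by rewrite lee_fin.
Qed.

(** Near-optimal covers of the [A n], with excess [e / 2 ^ n.+1], together cover the union with
    total excess at most [e]. *)
Lemma riesz_outer_sigma_subadditive : sigma_subadditive riesz_outer.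
Proof.
move=> A; apply/lee_addgt0Pr => e e0.
apply: (le_trans _ (epsilon_trick xpredT (fun n => riesz_outer_ge0 (A n)) (ltW e0))).
pose P n psi := riesz_cover (A n) psi /\
  (\sum_(k <oo) (L (psi k))%:E <= riesz_outer (A n) + (e / (2 ^ n.+1)%:R)%:E)%E.
have [G PG] : {G : nat -> nat -> X -> R & forall n, P n (G n)}.
  apply: (@choice _ _ P) => n.
  have en1 : 0 < e / (2 ^ n.+1)%:R by rewrite divr_gt0// ltr0n expn_gt0.
  have [x [psi cpsi <-] hx] := lb_ereal_inf_adherent en1 (riesz_outer_fin (A n)).
  by exists psi; split => //; exact: ltW.
have G0 i j x : 0 <= G i j x by have [[_]] := PG i; exact.
have cG i j : continuous (G i j) by have [[]] := PG i.
apply: (@le_trans _ _ (\sum_(i <oo) \sum_(j <oo) (L (G i j))%:E)%E).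
  apply: riesz_outer_le_double => // x [n _ Ax].
  have [[_ _ h] _] := PG n; apply: (le_trans (h x Ax)).
  rewrite [leRHS](@nneseriesD1 _ _ n)//; last first.
    by move=> i _; apply: nneseries_ge0 => *; rewrite lee_fin.
  by rewrite leeDl// nneseries_ge0// => *; rewrite nneseries_ge0// => *; rewrite lee_fin.
apply: lee_nneseries => i _; last by have [] := PG i.
by move=> _; apply: nneseries_ge0 => *; rewrite lee_fin L_ge0.
Qed.

Let om : {outer_measure set X -> \bar R} := HB.pack riesz_outer
  (isOuterMeasure.Build R X riesz_outer riesz_outer0 riesz_outer_ge0
    le_riesz_outer riesz_outer_sigma_subadditive).

(* With [chi n] increasing to the indicator of [U] and a cover [psi] of [A], the
   functions [psi i * (chi n.+1 - chi n)] cover [A `&` U] and, for every [N], the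
   functions [psi i * (1 - chi N)] cover [A `&` ~` U]. *)
Lemma open_riesz_measurable (U : set X) : open U -> riesz_outer.-caratheodory U.
Proof.
move=> /open_positivity_set[h [ch h0 hU]].
apply: (@le_caratheodory_measurable _ _ om) => A.
rewrite /om/=; apply: le_ereal_inf_tmp => _ [psi [cpsi psi0 hpsi] <-].
pose chi n x : R := Num.min (n%:R * h x) 1.
have cchi n : continuous (chi n).
  by apply: min_cst_continuous => x; apply: cvgM; [exact: cvg_cst|exact: ch].
have chi0 x : chi 0%N x = 0 by rewrite /chi mul0r min_l.
have chi1 n x : chi n x <= 1 by rewrite /chi ge_min lexx orbT.
have chi_ge0 n x : 0 <= chi n x by rewrite /chi le_min ler01 mulr_ge0.
pose delta n x := chi n.+1 x - chi n x.
have cdelta n : continuous (delta n).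
  by move=> x; apply: cvgB; exact: cchi.
have delta0 n x : 0 <= delta n x.
  rewrite /delta subr_ge0 /chi le_min ge_min ge_min lexx orbT andbT.
  by rewrite ler_wpM2r// ler_nat.
have sumdelta n x : \sum_(0 <= k < n) delta k x = chi n x.
  by rewrite /delta telescope_sumr// chi0 subr0.
have cM a b : continuous a -> continuous b -> continuous (fun x => a x * b x).
  by move=> ca cb x; apply: cvgM; [exact: ca|exact: cb].
have LM0 i b : continuous b -> (forall x, 0 <= b x) ->
    (0 <= (L (fun x => psi i x * b x))%:E)%E.
  by move=> cb b0; rewrite lee_fin L_ge0//; [exact: cM|move=> x; rewrite mulr_ge0].
have cCchi n : continuous (fun x => 1 - chi n x).
  by move=> x; apply: cvgB; [exact: cvg_cst|exact: cchi].
have Cchi0 n x : 0 <= 1 - chi n x by rewrite subr_ge0.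
have key N : ((\sum_(0 <= n < N) \sum_(i <oo) (L (fun x => psi i x * delta n x))%:E)
    + riesz_outer (A `&` ~` U) <= \sum_(i <oo) (L (psi i))%:E)%E.
  rewrite -nneseries_sum_nat; last by move=> i j; exact: LM0.
  rewrite (@eq_eseriesr _ _ (fun i => (L (fun x => psi i x * chi N x))%:E)); last first.
    move=> i _; rewrite sumEFin -functional_sum; last by move=> j; exact: cM.
    congr (L _)%:E; apply/funext => x.
    by rewrite -mulr_sumr sumdelta.
  rewrite (@eq_eseriesr _ (fun i => (L (psi i))%:E)
    (fun i => (L (fun x => psi i x * chi N x))%:E +
      (L (fun x => psi i x * (1 - chi N x)))%:E)%E); last first.
    move=> i _; rewrite -EFinD -LD; [|exact: cM|exact: cM].
    by congr (L _)%:E; apply/funext => x; rewrite -mulrDr addrC subrK mulr1.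
  rewrite nneseriesD; [|by move=> *; exact: LM0|by move=> *; exact: LM0].
  apply: leeD2l; apply: ereal_inf_lbound.
  exists (fun i x => psi i x * (1 - chi N x)) => //; split.
  - by move=> i; exact: cM.
  - by move=> i x; rewrite mulr_ge0.
  - move=> x [Ax Ux]; have hx : h x = 0.
      apply/eqP; rewrite eq_le h0 andbT leNgt; apply/negP => hx.
      by apply: Ux; apply/hU.
    rewrite (@eq_eseriesr _ _ (fun i => (psi i x)%:E)) ?hpsi// => i _.
    by rewrite /chi hx mulr0 min_l// subr0 mulr1.
(* The outer measure of the part of [A] outside [U] is finite, so it moves to the right-hand side;
   that bound does not depend on [N] and passes to the limit of the series. *)
rewrite -leeBrDr ?riesz_outer_fin//.
apply: (@le_trans _ _ (\sum_(n <oo) \sum_(i <oo) (L (fun x => psi i x * delta n x))%:E)%E).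
  apply: (@riesz_outer_le_double _ (fun n i x => psi i x * delta n x)).
  - by move=> n i; exact: cM.
  - by move=> n i x; rewrite mulr_ge0.
  - move=> x [Ax /hU hx].
    rewrite (@eq_eseriesr _ _ (fun n => ((delta n x)%:E * \sum_(i <oo) (psi i x)%:E)%E)); last first.
      move=> n _; rewrite -nneseriesZl; last by move=> *; rewrite lee_fin.
      by apply: eq_eseriesr => i _; rewrite mulrC EFinM.
    apply: (@le_trans _ _ (\sum_(n <oo) (delta n x)%:E)%E); last first.
      apply: lee_nneseries => n *; first by rewrite lee_fin.
      by rewrite lee_pemulr ?lee_fin//; exact: hpsi.
    (* [N.+1 * h x >= 1], so [chi N.+1 x = 1] and the first [N.+1] terms already reach 1. *)
    pose N := Num.truncn (h x)^-1.
    have : (1 <= \sum_(0 <= n < N.+1) (delta n x)%:E)%E.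
      rewrite sumEFin sumdelta lee_fin /chi le_min lexx andbT.
      by rewrite -ler_pdivrMr// div1r ltW// truncnS_gt.
    move/le_trans; apply; apply: nneseries_lim_ge => *; rewrite lee_fin//.
apply: lime_le.
  by apply: is_cvg_nneseries => *; apply: nneseries_ge0 => *; exact: LM0.
by apply: nearW => N; rewrite leeBrDr ?riesz_outer_fin//; exact: key.
Qed.

Lemma borel_riesz_measurable (A : set (Borel X)) :
  measurable A -> riesz_outer.-caratheodory A.
Proof.
apply: smallest_sub; last by move=> U; exact: open_riesz_measurable.
split.
- exact: (caratheodory_measurable_set0 om).
- by move=> B; rewrite setTD; exact: (@caratheodory_measurable_setC _ _ om).
- exact: (@caratheodory_measurable_bigcup _ _ om).
Qed.

Lemma riesz_outer_semi_sigma_additive :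
  semi_sigma_additive (riesz_outer : set (Borel X) -> \bar R).
Proof.
move=> F mF tF mUF.
apply: (@caratheodory_measure_sigma_additive R X om F) => //.
- by move=> i; exact: borel_riesz_measurable.
- exact: borel_riesz_measurable.
Qed.

(** By compactness, finitely many functions of a cover of the whole space sum to more than [1 - e]
    everywhere, so they cost at least [1 - e]. *)
Lemma riesz_outerT : riesz_outer setT = 1%E.
Proof.
apply/eqP; rewrite eq_le riesz_outer_le1/=.
apply: le_ereal_inf_tmp => _ [psi [cpsi psi0 hpsi] <-].
apply/lee_addgt0Pr => e e0.
pose s n x := \sum_(0 <= i < n) psi i x.
have cs n : continuous (s n) by exact: continuous_sum.
have [n hn] : exists n, forall x, 1 - e < s n x.
  apply: monotone_compact_cover => //.
    move=> x m n mn; rewrite /s (big_cat_nat _ mn)//= lerDl.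
    by rewrite sumr_ge0.
  move=> x; apply: contrapT => H.
  have : (1 <= (1 - e)%:E :> \bar R)%E.
    apply: (le_trans (hpsi x I)); apply: lime_le.
      by apply: is_cvg_nneseries => *; rewrite lee_fin.
    apply: nearW => n; rewrite sumEFin lee_fin leNgt; apply/negP => hn.
    by apply: H; exists n.
  by rewrite lee_fin; lra.
have : ((1 - e)%:E <= \sum_(i <oo) (L (psi i))%:E)%E.
  apply: (@le_trans _ _ (\sum_(0 <= i < n) (L (psi i))%:E)%E); last first.
    by apply: nneseries_lim_ge => *; rewrite lee_fin L_ge0.
  rewrite sumEFin lee_fin -functional_sum//.
  have -> : 1 - e = L (fun=> (1 - e) * 1).
    by rewrite LZ ?L1 ?mulr1//; exact: cst_continuous.
  apply: le_functional; [exact: cst_continuous|exact: cs|].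
  by move=> x /=; rewrite mulr1; exact: ltW (hn x).
by move=> /(leeD2r e%:E); rewrite -EFinD subrK.
Qed.

(** A separate name at the type of sets of [Borel X], to which the measure and probability
    structures are attached. *)
Let riesz_measure : set (Borel X) -> \bar R := riesz_outer.

HB.instance Definition _ := isMeasure.Build _ (Borel X) R riesz_measure
  riesz_outer0 riesz_outer_ge0 riesz_outer_semi_sigma_additive.

HB.instance Definition _ :=
  Measure_isProbability.Build _ (Borel X) R riesz_measure riesz_outerT.

Let mu : probability (Borel X) R := riesz_measure.

(** With [A] the set where [a >= 1], [b] lies below the indicator of [A] and [a] alone covers [A],
    so the integral of [b] is at most [mu A <= L a]. *)
Lemma integ_le_functional_slice a b : continuous a -> continuous b ->
  (forall x, 0 <= a x) -> (forall x, 0 <= b x <= 1) ->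
  (forall x, 0 < b x -> 1 <= a x) -> integ mu b <= L a.
Proof.
move=> ca cb a0 b01 ab.
pose A : set (Borel X) := [set x | 1 <= a x].
have mA : measurable A.
  have := continuous_measurable _ ca measurableT `[1, +oo[%classic.
  rewrite setTI => /(_ (measurable_itv _)); congr (measurable _).
  by apply/seteqP; split => x; rewrite /A /= in_itv/= andbT.
have ib := continuous_integrable cX mu _ cb.
rewrite -lee_fin /integ /Rintegral fineK; last exact: integrable_fin_num.
apply: (le_trans _ (riesz_outer_le A a ca a0 (fun x h => h))).
have -> : riesz_outer A = (\int[mu]_x (\1_A x)%:E)%E.
  by rewrite integral_indic// setIT.
apply: ge0_le_integral => //.
- by move=> x _; rewrite lee_fin; case/andP: (b01 x).
- by apply/measurable_EFinP; exact: continuous_measurable.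
- by apply/measurable_EFinP; exact: measurable_indic.
- move=> x _; rewrite lee_fin indicE; have /andP[b0 b1] := b01 x.
  case: (ltP 0 (b x)) => [/ab Ax|/le_trans ->//].
  by rewrite mem_set.
Qed.

(* [a] is cut into the slices [s j] of height [e] between the levels [j * e] and
   [j.+1 * e]; [s j] equals [e] wherever [s j.+1] is positive, so the integral of
   [s j.+1] is at most [L (s j)]. *)
Lemma integ_le_functional a : continuous a -> (forall x, 0 <= a x) ->
  integ mu a <= L a.
Proof.
move=> ca a0; apply/ler_addgt0Pl => e e0.
have [M M0 aM] := continuous_fun_bounded cX _ ca.
pose c j x := Num.min (a x) (j%:R * e).
have cc j : continuous (c j) by exact: min_cst_continuous.
pose s j x := c j.+1 x - c j x.
have cs j : continuous (s j) by move=> x; apply: cvgB; exact: cc.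
have sum_s K x : \sum_(0 <= j < K) s j x = c K x.
  by rewrite /s telescope_sumr// /c mul0r (min_r (a0 x)) subr0.
have sE j x : 0 <= s j x <= e /\ (0 < s j.+1 x -> s j x = e).
  rewrite /s /c -(natr1 j.+1) -(natr1 j) !mulrDl mul1r.
  move: (j%:R * e) (a x) => u p.
  by split; [apply/andP; split|];
    case: (leP p u); case: (leP p (u + e)); case: (leP p (u + e + e)); lra.
(* [K.+1 * e] exceeds the bound [M] of [a], so [K.+1] slices exhaust [a]. *)
pose K := Num.truncn (M / e).
have hK x : c K.+1 x = a x.
  rewrite /c min_l// (le_trans (ler_norm _))// (le_trans (aM x))//.
  by rewrite -ler_pdivrMr// ltW// truncnS_gt.
have -> : a = (fun x => \sum_(j < K.+1) s j x).
  by apply/funext => x; rewrite -[LHS]hK -sum_s big_mkord.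
(* The bottom slice integrates to at most [e]; slice [j.+1] is compared with slice [j], and the top
   slice is dropped on the side of [L]. *)
rewrite integ_sum// big_ord_recl/= lerD//.
  rewrite -[leRHS](integ_cst mu); apply: le_integ => //.
    exact: cst_continuous.
  by move=> x; have [/andP[]] := sE 0%N x.
apply: (@le_trans _ _ (L (fun x => \sum_(0 <= j < K) s j x))); last first.
  apply: le_functional; [exact: continuous_sum|exact: continuous_sum|].
  move=> x; rewrite -(big_mkord xpredT (s ^~ x)) big_nat_recr//= lerDl.
  by have [/andP[]] := sE K x.
rewrite functional_sum// big_mkord ler_sum// => j _.
have cZ k : continuous (fun x => e^-1 * s k x).
  by move=> x; apply: cvgM; [exact: cvg_cst|exact: cs].
rewrite -(ler_pM2l (_ : 0 < e^-1)) ?invr_gt0// -LZ// -integZ//.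
apply: integ_le_functional_slice => // x.
- by rewrite mulr_ge0 ?invr_ge0 ?(ltW e0)//; have [/andP[]] := sE j x.
- have [/andP[s0 s1] _] := sE j.+1 x.
  by rewrite mulr_ge0 ?invr_ge0 ?(ltW e0)//= mulrC ler_pdivrMr// mul1r.
- rewrite pmulr_rgt0 ?invr_gt0// => /(proj2 (sE j x)) ->.
  by rewrite mulVf// gt_eqF.
Qed.

(** Adding a constant extends the inequality from nonnegative to all continuous functions, and
    applying it to [- psi] gives equality. The formula for [mu A] is kept for the proof of
    invariance. *)
Theorem riesz_probability : exists2 mu : probability (Borel X) R,
  forall A, mu A = riesz_outer A &
  forall psi, continuous psi -> integ mu psi = L psi.
Proof.
exists mu => //.
have le a : continuous a -> integ mu a <= L a.
  move=> ca; have [M M0 aM] := continuous_fun_bounded cX _ ca.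
  have cM : continuous (fun _ : X => M) by exact: cst_continuous.
  have -> : a = (fun x => (a x + M) + (- 1) * (fun=> M) x).
    by apply/funext => x; rewrite mulN1r addrK.
  have caM : continuous (fun x => a x + M).
    by move=> x; apply: cvgD; [exact: ca|exact: cM].
  have cNM : continuous (fun x : X => - 1 * (fun=> M) x) by exact: cst_continuous.
  rewrite integD// LD// integZ// LZ// integ_cst.
  have -> : L (fun=> M) = M.
    have := LZ M _ (@cst_continuous X R 1); rewrite L1 mulr1 => {2}<-.
    by congr L; apply/funext => x; rewrite mulr1.
  rewrite lerD2r; apply: integ_le_functional => // x.
  have := aM x; rewrite ler_norml => /andP[]; lra.
move=> psi cpsi; apply/eqP; rewrite eq_le le//=.
have cN : continuous (fun x => - 1 * psi x).
  by move=> x; apply: cvgM; [exact: cvg_cst|exact: cpsi].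
by have := le _ cN; rewrite integZ// LZ// !mulN1r lerN2.
Qed.

End riesz.

(** * Products of numbers in [0,1] *)

Section bounded_products.
Context {R : realDomainType}.
Implicit Types (u : nat -> R) (p : nat -> R).

Lemma prod_itv01 u m n : (forall j, 0 <= u j <= 1) ->
  0 <= \prod_(m <= j < n) u j <= 1.
Proof.
move=> u01; apply/andP; split.
  by apply: prodr_ge0 => j _; case/andP: (u01 j).
by apply: prodr_ile1 => j _; exact: u01.
Qed.

(** Induction from [1 - P * v <= (1 - P) + (1 - v)] for [P] and [v] in [0,1]; the bounding sum does
    not depend on [m] or [k]. *)
Lemma one_sub_prod_le u m k n : (forall j, 0 <= u j <= 1) -> (k <= n)%N ->
  1 - \prod_(m <= j < k) u j <= \sum_(0 <= j < n) (1 - u j).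
Proof.
move=> u01 kn.
have u1 j : 0 <= 1 - u j by rewrite subr_ge0; case/andP: (u01 j).
apply: (@le_trans _ _ (\sum_(0 <= j < k) (1 - u j))); last first.
  by rewrite [leRHS](big_cat_nat _ kn)//= lerDl sumr_ge0.
elim: k {kn} => [|k IH]; first by rewrite !big_nil ?big_geq// subrr.
have [mk|km] := leqP m k; last by rewrite big_geq// subrr sumr_ge0.
rewrite !big_nat_recr//=.
have /andP[p0 p1] := prod_itv01 u m k u01; have := u1 k.
by move: (\prod_(_ <= _ < _) _) (\sum_(_ <= _ < _) _) (u k) IH p0 p1 => P S v; nra.
Qed.

(* Summation by parts: with [V k = a k * b k * p k], the [k]-th term differs from
   [V k.+1 - V k] by at most [M * ((b k - b k.+1) + (a k.+1 - a k))]. *)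
Lemma weighted_increments_le (a b : nat -> R) p M n :
  (forall k, 0 <= a k <= 1) -> (forall k, 0 <= b k <= 1) ->
  (forall k, a k <= a k.+1) -> (forall k, b k.+1 <= b k) ->
  (forall k, `|p k| <= M) ->
  `|\sum_(0 <= k < n) a k.+1 * b k * (p k.+1 - p k)| <= 4%:R * M.
Proof.
move=> a01 b01 aM bM pM.
have M0 : 0 <= M := le_trans (normr_ge0 _) (pM 0%N).
pose V k := a k * b k * p k.
pose D k := a k.+1 * (b k - b k.+1) * p k.+1 - (a k.+1 - a k) * b k * p k.
have VM k : `|V k| <= M.
  have /andP[a0 a1] := a01 k; have /andP[b0 b1] := b01 k.
  rewrite /V normrM ger0_norm ?mulr_ge0// -[leRHS]mul1r ler_pM ?mulr_ge0//.
  by rewrite mulr_ile1.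
have DM k : `|D k| <= M * (b k - b k.+1) + M * (a k.+1 - a k).
  have /andP[a0 a1] := a01 k.+1; have /andP[b0 b1] := b01 k.
  have db : 0 <= b k - b k.+1 by rewrite subr_ge0.
  have da : 0 <= a k.+1 - a k by rewrite subr_ge0.
  apply: (le_trans (ler_normB _ _)); rewrite !normrM lerD//.
    rewrite (ger0_norm a0) (ger0_norm db) [leRHS]mulrC ler_pM ?mulr_ge0//.
    by rewrite -[leRHS]mul1r ler_wpM2r.
  rewrite (ger0_norm b0) (ger0_norm da) [leRHS]mulrC ler_pM ?mulr_ge0//.
  by rewrite -[leRHS]mulr1 ler_wpM2l.
have -> : \sum_(0 <= k < n) a k.+1 * b k * (p k.+1 - p k) =
    (V n - V 0%N) + \sum_(0 <= k < n) D k.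
  rewrite -(telescope_sumr V)// -big_split/=; apply: eq_bigr => k _.
  by rewrite /V /D; ring.
apply: (le_trans (ler_normD _ _)).
(* The boundary terms cost [2 * M]; the variations of [a] and [b], at most 1 each, cost the other
   [2 * M]. *)
have -> : 4%:R * M = (M + M) + (M + M) by ring.
apply: lerD; first by apply: (le_trans (ler_normB _ _)); exact: lerD.
apply: (le_trans (ler_norm_sum _ _ _)).
apply: (@le_trans _ _ (\sum_(0 <= k < n)
  ((M * - b k.+1 - M * - b k) + (M * a k.+1 - M * a k)))).
  apply: ler_sum => k _; apply: (le_trans (DM k)).
  by rewrite le_eqVlt; apply/orP; left; apply/eqP; ring.
rewrite big_split/= (telescope_sumr (fun k => M * - b k))//.
rewrite (telescope_sumr (fun k => M * a k))//.
have /andP[a0 a1] := a01 n; have /andP[b0 b1] := b01 n.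
have /andP[a00 a11] := a01 0%N; have /andP[b00 b11] := b01 0%N.
by nra.
Qed.

End bounded_products.

(** * Norms of upper triangular matrices *)

Section opnorm2_upper_triangular.
Context {R : realType}.
Implicit Types M : 'M[R]_2.

Lemma sqrt_sum_sqr_le (s t : R) : Num.sqrt (s ^+ 2 + t ^+ 2) <= `|s| + `|t|.
Proof.
rewrite -[leRHS]ger0_norm ?addr_ge0// -sqrtr_sqr ler_sqrt ?sqr_ge0//.
rewrite sqrrD !real_normK ?num_real// -addrA lerD2l lerDr.
by rewrite mulrn_wge0// mulr_ge0.
Qed.

Lemma norm_le_sqrt_sum_sqr (s t : R) : `|s| <= Num.sqrt (s ^+ 2 + t ^+ 2).
Proof. by rewrite -sqrtr_sqr ler_wsqrtr// lerDl sqr_ge0. Qed.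

(** The image of the second basis vector gives the lower bound. A unit vector has coordinates of
    modulus at most 1, which gives the upper bound through the l1 norm of its image. *)
Lemma opnorm2_upper_le M : M 1 0 = 0 -> `|M 0 0| <= 1 -> `|M 1 1| <= 1 ->
  `|M 0 1| <= opnorm2 M <= `|M 0 1| + 2%:R.
Proof.
move=> M10 M00 M11.
have l1 : lift (@ord0 1) ord0 = 1 by apply/val_inj.
have o0 : (@ord0 1) = 0 by [].
have sum2 (F : 'I_2 -> R) : \sum_(i < 2) F i = F 0 + F 1.
  by rewrite big_ord_recl big_ord1 l1.
rewrite /opnorm2; set E := (X in sup X).
have ubE r : E r -> r <= `|M 0 1| + 2%:R.
  move=> [v]; rewrite /= sum2 => v1 <-; rewrite sum2 !mxE !sum2 M10 mul0r add0r.
  have v01 : `|v 0 0| <= 1 /\ `|v 1 0| <= 1.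
    by split; rewrite -[leRHS](@sqrtr1 R) -v1 ?norm_le_sqrt_sum_sqr//
      addrC norm_le_sqrt_sum_sqr.
  apply: (le_trans (sqrt_sum_sqr_le _ _)); rewrite normrM.
  apply: (@le_trans _ _ ((1 + `|M 0 1|) + 1)); last by lra.
  apply: lerD; last by rewrite mulr_ile1//; case: v01.
  apply: (le_trans (ler_normD _ _)); rewrite !normrM lerD//.
    by rewrite mulr_ile1//; case: v01.
  by rewrite -[leRHS]mulr1 ler_wpM2l//; case: v01.
pose e2 : 'cV[R]_2 := \col_i (i == 1)%:R.
have Ee2 : E (Num.sqrt (M 0 1 ^+ 2 + M 1 1 ^+ 2)).
  exists e2; first by rewrite /= sum2 !mxE/= expr0n expr1n add0r.
  by rewrite sum2 !mxE !sum2 !mxE/= !mulr0 !add0r !mulr1.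
apply/andP; split.
  apply: (le_trans (norm_le_sqrt_sum_sqr _ (M 1 1))).
  by apply: ub_le_sup Ee2; exists (`|M 0 1| + 2%:R) => r; exact: ubE.
by apply: ge_sup; [exists (Num.sqrt (M 0 1 ^+ 2 + M 1 1 ^+ 2))|exact: ubE].
Qed.

End opnorm2_upper_triangular.

(** The values lie in a compact segment, and a cluster point of an ultrafilter is a limit. A single
    ultrafilter thus gives limits for all test functions at once, with no extraction of
    subsequences. *)
Lemma bounded_ultra_cvg (R : realType) (I : Type) (U : set_system I)
    (u : I -> R) (M : R) :
  UltraFilter U -> (forall n, `|u n| <= M) -> cvg (u @ U).
Proof.
move=> UU uM.
have [l [_ cl]] : `[- M, M]%classic `&` cluster (u @ U) !=set0.
  apply: segment_compact.
  have uU : U (u @^-1` `[- M, M]) by apply: filterS filterT => n _ /=;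
    rewrite in_itv/= -ler_norml.
  exact: uU.
apply/cvg_ex; exists l => B nB.
have [//|UB] := in_ultra_setVsetC (u @^-1` B) UU.
have uB : (u @ U) (~` B) by [].
by have [y [nBy By]] := cl _ _ uB nB.
Qed.

(** * Invariance of the representing measure *)

Section invariant_functional.
Context {R : realType} {X : pmetricType R}.
Variables (T : X -> X) (L : (X -> R) -> R).
Hypothesis cT : continuous T.
Hypothesis LT : forall psi, continuous psi -> L (psi \o T) = L psi.

(** Composing a cover of [A] with [T] covers the preimage at the same cost. *)
Lemma riesz_outer_preimage_le (A : set X) :
  (riesz_outer L (T @^-1` A) <= riesz_outer L A)%E.
Proof.
apply: le_ereal_inf_tmp => _ [psi [cpsi psi0 hpsi] <-].
apply: ereal_inf_lbound; exists (fun i => psi i \o T).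
  split; last by move=> x; exact: hpsi.
    by move=> i x; apply: continuous_comp; [exact: cT|exact: cpsi].
  by move=> i x; exact: psi0.
by apply: eq_eseriesr => i _; rewrite LT.
Qed.

(** The inequality for [A] and for its complement, whose measures add up to 1, forces equality. *)
Lemma riesz_invariant (mu : probability (Borel X) R) :
  (forall A, mu A = riesz_outer L A) -> invariant_measures T mu.
Proof.
move=> muE A mA.
have mTA : measurable (T @^-1` A : set (Borel X)).
  rewrite -[X in measurable X]setTI.
  exact: (continuous_measurable_map _ cT measurableT _ mA).
have le B : (mu (T @^-1` B) <= mu B)%E by rewrite !muE riesz_outer_preimage_le.
apply/eqP; rewrite eq_le le/=.
have := le (~` A); rewrite preimage_setC.
rewrite (probability_setC mu mA) (probability_setC mu mTA).
rewrite -(fineK (fin_num_measure mu _ mA)) -(fineK (fin_num_measure mu _ mTA)).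
by rewrite -!EFinB !lee_fin; lra.
Qed.

End invariant_functional.

(** * Growth of the triangular cocycle *)

Section triangular_cocycle.
Context {R : realType} {X : pmetricType R}.
Variables (T : X -> X) (f g phi : X -> R).
Hypothesis cX : compact [set: X].
Hypotheses (cT : continuous T) (cf : continuous f) (cg : continuous g).
Hypothesis cphi : continuous phi.
Hypotheses (f01 : forall x, 0 < f x <= 1) (g01 : forall x, 0 < g x <= 1).

Implicit Types (psi : X -> R) (r : R).

(* The upper right entry of the [n]-th product is [offdiag n x]: the [k]-th
   summand uses [g] at times before [k], [phi] at [k] and [f] after [k]. *)
Definition weight n x k :=
  (\prod_(k.+1 <= j < n) f (iter j T x)) * \prod_(0 <= j < k) g (iter j T x).

Definition offdiag n x :=
  \sum_(0 <= k < n) weight n x k * phi (iter k T x).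

Let A := Amat f g phi.
Let K n := sup [set opnorm2 (cocycle A T n x) | x in [set: X]].

Lemma offdiagS n x : offdiag n.+1 x = f (iter n T x) * offdiag n x +
  phi (iter n T x) * \prod_(0 <= j < n) g (iter j T x).
Proof.
rewrite /offdiag big_nat_recr//= [phi _ * _]mulrC.
congr (_ + _); last by rewrite /weight big_geq// mul1r.
rewrite mulr_sumr; apply: eq_big_nat => k /andP[_ kn].
by rewrite /weight big_nat_recr//=; ring.
Qed.

Lemma cocycle_entries n x : let M := cocycle A T n x in
  [/\ M 0 0 = \prod_(0 <= j < n) f (iter j T x), M 0 1 = offdiag n x,
      M 1 0 = 0 & M 1 1 = \prod_(0 <= j < n) g (iter j T x)].
Proof.
have l1 : lift (@ord0 1) ord0 = 1 by apply/val_inj.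
elim: n => [|n [IH00 IH01 IH10 IH11]] /=.
  by rewrite /offdiag !big_geq//; split; rewrite !mxE.
rewrite offdiagS !(big_nat_recr n)//=.
split; rewrite !mxE big_ord_recl big_ord1 l1 ?IH00 ?IH01 ?IH10 ?IH11 !mxE/=.
- by rewrite mulr0 addr0 mulrC.
- by [].
- by rewrite mul0r mulr0 addr0.
- by rewrite mul0r add0r mulrC.
Qed.

Let f01' x j : 0 <= f (iter j T x) <= 1.
Proof. by have /andP[/ltW -> ->] := f01 (iter j T x). Qed.

Let g01' x j : 0 <= g (iter j T x) <= 1.
Proof. by have /andP[/ltW -> ->] := g01 (iter j T x). Qed.

Lemma weight01 n x k : 0 <= weight n x k <= 1.
Proof.
have /andP[a0 a1] := prod_itv01 (fun j => f (iter j T x)) k.+1 n (f01' x).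
have /andP[b0 b1] := prod_itv01 (fun j => g (iter j T x)) 0 k (g01' x).
by rewrite /weight mulr_ge0//= mulr_ile1.
Qed.

Lemma opnorm2_cocycle n x :
  `|offdiag n x| <= opnorm2 (cocycle A T n x) <= `|offdiag n x| + 2%:R.
Proof.
have [M00 M01 M10 M11] := cocycle_entries n x.
rewrite -M01; apply: opnorm2_upper_le => //.
- rewrite M00 ger0_norm;
  by have /andP[] := prod_itv01 (fun j => f (iter j T x)) 0 n (f01' x).
- rewrite M11 ger0_norm;
  by have /andP[] := prod_itv01 (fun j => g (iter j T x)) 0 n (g01' x).
Qed.

Lemma weighted_sum_le n x (C : R) (p : nat -> R) : (forall k, `|p k| <= C) ->
  `|\sum_(0 <= k < n) weight n x k * p k| <= n%:R * C.
Proof.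
move=> pC; apply: (le_trans (ler_norm_sum _ _ _)).
apply: (@le_trans _ _ (\sum_(0 <= k < n) C)); last first.
  by rewrite sumr_const_nat subn0 mulr_natl.
apply: ler_sum => k _; have /andP[w0 w1] := weight01 n x k.
by rewrite normrM ger0_norm// -[leRHS]mul1r ler_pM.
Qed.

(** Makes [K n] a genuine supremum: [sup] defaults to 0 on an unbounded set. *)
Let has_sup_growth n : has_sup [set opnorm2 (cocycle A T n x) | x in [set: X]].
Proof.
split; first by exists (opnorm2 (cocycle A T n point)), point.
have [C C0 hC] := continuous_fun_bounded cX _ cphi.
exists (n%:R * C + 2%:R) => _ [x _ <-].
have /andP[_ h] := opnorm2_cocycle n x; apply: (le_trans h).
by rewrite lerD2r; apply: weighted_sum_le => k; exact: hC.
Qed.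

Lemma offdiag_le_growth n x : `|offdiag n x| <= K n.
Proof.
have /andP[h _] := opnorm2_cocycle n x; apply: (le_trans h).
by apply: ub_le_sup; [case: (has_sup_growth n)|exists x].
Qed.

(** The 3 is 2 from the norm estimate plus 1 from choosing [x] within 1 of the supremum. *)
Lemma growth_le_offdiag n : exists x, K n <= `|offdiag n x| + 3%:R.
Proof.
have [_ [x _ <-] h] := sup_adherent ltr01 (has_sup_growth n).
exists x; have /andP[_ h2] := opnorm2_cocycle n x.
by rewrite -/(K n) in h; lra.
Qed.

(** * Lower bound by maximising measures *)

Lemma iter_continuous k : continuous (iter k T).
Proof.
elim: k => [|k IH] x; first exact: cvg_id.
by apply: (@continuous_comp _ _ _ (iter k T) T); [exact: IH|exact: cT].
Qed.

Lemma comp_iter_continuous (psi : X -> R) k : continuous psi ->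
  continuous (fun x => psi (iter k T x)).
Proof.
move=> cpsi x; apply: (@continuous_comp _ _ _ (iter k T) psi).
  exact: iter_continuous.
exact: cpsi.
Qed.

Lemma integ_iter mu (psi : X -> R) k : invariant_measures T mu ->
  continuous psi -> integ mu (fun x => psi (iter k T x)) = integ mu psi.
Proof.
move=> imu cpsi; elim: k => [//|k IH]; rewrite -IH.
rewrite -[RHS](integ_invariant cX _ _ _ imu cT (comp_iter_continuous _ k cpsi)).
by congr integ; apply/funext => x /=; rewrite -iterSr.
Qed.

(** Each weight is within [D] of 1, so the Birkhoff sum [S] of [phi] differs from [offdiag n] by at
    most [n * C * D]. As [D] integrates to 0, integrating [|S| <= K n + n * C * D] leaves only [K n]
    on the right. *)
Lemma integ_le_growth mu n : invariant_measures T mu ->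
  integ mu (fun x => ln (f x)) = 0 -> integ mu (fun x => ln (g x)) = 0 ->
  n%:R * `|integ mu phi| <= K n.
Proof.
move=> imu lnf lng.
have [C C0 hC] := continuous_fun_bounded cX _ cphi.
have c1 (h : X -> R) : continuous h -> continuous (fun x => 1 - h x).
  by move=> ch x; apply: cvgB; [exact: cvg_cst|exact: ch].
pose d x := (1 - f x) + (1 - g x).
have cd : continuous d by move=> x; apply: cvgD; [exact: c1|exact: c1].
have d0 : integ mu d = 0.
  rewrite integD//; [|exact: c1|exact: c1].
  by rewrite !integ_one_sub_eq0// addr0.
pose S x := \sum_(k < n) phi (iter k T x).
pose D x := \sum_(j < n) d (iter j T x).
have cS : continuous S.
  by apply: continuous_sum => k; exact: comp_iter_continuous.
have cD : continuous D.
  by apply: continuous_sum => k; exact: comp_iter_continuous.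
have iS : integ mu S = n%:R * integ mu phi.
  rewrite (integ_sum cX mu n (fun k x => phi (iter k T x))); last first.
    by move=> k; exact: comp_iter_continuous.
  under eq_bigr do rewrite integ_iter//.
  by rewrite sumr_const card_ord mulr_natl.
have iD : integ mu D = 0.
  rewrite (integ_sum cX mu n (fun k x => d (iter k T x))); last first.
    by move=> k; exact: comp_iter_continuous.
  by under eq_bigr do rewrite integ_iter// d0; rewrite big1.
have wD x k : (k < n)%N -> 1 - weight n x k <= D x.
  move=> kn.
  have /andP[a0 a1] := prod_itv01 (fun j => f (iter j T x)) k.+1 n (f01' x).
  have ha := one_sub_prod_le (fun j => f (iter j T x)) k.+1 n n (f01' x) (leqnn n).
  have /andP[b0 b1] := prod_itv01 (fun j => g (iter j T x)) 0 k (g01' x).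
  have hb := one_sub_prod_le (fun j => g (iter j T x)) 0 k n (g01' x) (ltnW kn).
  have -> : D x = \sum_(0 <= j < n) (1 - f (iter j T x)) +
      \sum_(0 <= j < n) (1 - g (iter j T x)).
    by rewrite -big_split/= big_mkord.
  (* Uses [1 - u * v <= (1 - u) + (1 - v)] for the two partial products. *)
  by apply: (le_trans _ (lerD ha hb)); rewrite /weight; nra.
have bound x : `|S x| <= K n + n%:R * C * D x.
  have -> : S x = offdiag n x +
      \sum_(0 <= k < n) (1 - weight n x k) * phi (iter k T x).
    rewrite /S /offdiag -big_split/= -(big_mkord xpredT (fun k => phi (iter k T x))).
    by apply: eq_bigr => k _; ring.
  apply: (le_trans (ler_normD _ _)); apply: lerD; first exact: offdiag_le_growth.
  apply: (le_trans (ler_norm_sum _ _ _)).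
  apply: (@le_trans _ _ (\sum_(0 <= k < n) (C * D x))); last first.
    by rewrite sumr_const_nat subn0 -[leLHS]mulr_natl mulrA.
  rewrite big_nat [leRHS]big_nat; apply: ler_sum => k /andP[_ kn].
  have /andP[w0 w1] := weight01 n x k.
  have w1' : 0 <= 1 - weight n x k by rewrite subr_ge0.
  by rewrite normrM mulrC (ger0_norm w1') ler_pM// wD.
have cB : continuous (fun x => n%:R * C * D x).
  by move=> x; apply: cvgM; [exact: cvg_cst|exact: cD].
have cB' : continuous (fun x => K n + n%:R * C * D x).
  by move=> x; apply: cvgD; [exact: cvg_cst|exact: cB].
have iB : integ mu (fun x => K n + n%:R * C * D x) = K n.
  rewrite integD//; last exact: cst_continuous.
  by rewrite integ_cst integZ// iD mulr0 addr0.
have nE : n%:R = `|n%:R : R| by rewrite ger0_norm.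
rewrite nE -normrM -iS ler_norml; apply/andP; split.
  rewrite lerNl -[leRHS]iB -mulN1r -integZ//; apply: le_integ => //.
    by move=> x; apply: cvgM; [exact: cvg_cst|exact: cS].
  by move=> x; rewrite mulN1r (le_trans _ (bound x))// -normrN ler_norm.
by rewrite -[leRHS]iB; apply: le_integ => // x; rewrite (le_trans _ (bound x))// ler_norm.
Qed.

(** * Telescoping estimates for the weights *)

Let a n x k := \prod_(k <= j < n) f (iter j T x).
Let b x k := \prod_(0 <= j < k) g (iter j T x).

Let a01 n x k : 0 <= a n x k <= 1.
Proof. exact: (prod_itv01 (fun j => f (iter j T x)) k n (f01' x)). Qed.

Let b01 x k : 0 <= b x k <= 1.
Proof. exact: (prod_itv01 (fun j => g (iter j T x)) 0 k (g01' x)). Qed.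

Let aS n x k : (k < n)%N -> a n x k = f (iter k T x) * a n x k.+1.
Proof. by move=> kn; rewrite /a big_ltn. Qed.

Let bS x k : b x k.+1 = b x k * g (iter k T x).
Proof. by rewrite /b big_nat_recr. Qed.

(** With [f] taken at time [k], [a n x k.+1 * (1 - f) = a n x k.+1 - a n x k]; the factor
    [b x k <= 1] is dropped and the sum telescopes. *)
Lemma weight_one_sub_f n x :
  `|\sum_(0 <= k < n) weight n x k * (1 - f (iter k T x))| <= 1.
Proof.
have wE k : weight n x k = a n x k.+1 * b x k by [].
rewrite ger0_norm; last first.
  apply: sumr_ge0 => k _; have /andP[a0 _] := a01 n x k.+1.
  have /andP[b0 _] := b01 x k; have /andP[_ f1] := f01' x k.
  by rewrite wE !mulr_ge0// subr_ge0.
apply: (@le_trans _ _ (\sum_(0 <= k < n) (a n x k.+1 - a n x k))).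
  rewrite big_nat [leRHS]big_nat; apply: ler_sum => k /andP[_ kn].
  rewrite wE (aS _ _ _ kn); have /andP[a0 a1] := a01 n x k.+1.
  have /andP[b0 b1] := b01 x k; have /andP[f0 f1] := f01' x k.
  have -> : a n x k.+1 - f (iter k T x) * a n x k.+1 =
    a n x k.+1 * 1 * (1 - f (iter k T x)) by ring.
  by rewrite ler_wpM2r ?subr_ge0// ler_wpM2l.
rewrite telescope_sumr//; have /andP[a0 a1] := a01 n x n.
by have /andP[? ?] := a01 n x 0; lra.
Qed.

(** Here [b x k * (1 - g) = b x k - b x k.+1] telescopes, once the factor [a n x k.+1 <= 1] is
    dropped. *)
Lemma weight_one_sub_g n x :
  `|\sum_(0 <= k < n) weight n x k * (1 - g (iter k T x))| <= 1.
Proof.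
have wE k : weight n x k = a n x k.+1 * b x k by [].
rewrite ger0_norm; last first.
  apply: sumr_ge0 => k _; have /andP[a0 _] := a01 n x k.+1.
  have /andP[b0 _] := b01 x k; have /andP[_ g1] := g01' x k.
  by rewrite wE !mulr_ge0// subr_ge0.
apply: (@le_trans _ _ (\sum_(0 <= k < n) (- b x k.+1 - - b x k))).
  apply: ler_sum => k _.
  rewrite wE bS; have /andP[a0 a1] := a01 n x k.+1.
  have /andP[b0 b1] := b01 x k; have /andP[g0 g1] := g01' x k.
  have -> : - (b x k * g (iter k T x)) - - b x k =
    1 * b x k * (1 - g (iter k T x)) by ring.
  by rewrite ler_wpM2r ?subr_ge0// ler_wpM2r.
rewrite (telescope_sumr (fun k => - b x k))//; have /andP[b0 b1] := b01 x n.
by have /andP[? ?] := b01 x 0; lra.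
Qed.

(** Applies [weighted_increments_le] along the orbit; this makes limits of weighted means
    invariant. *)
Lemma weight_coboundary n x (psi : X -> R) (M : R) :
  (forall y, `|psi y| <= M) ->
  `|\sum_(0 <= k < n) weight n x k * (psi (T (iter k T x)) - psi (iter k T x))|
    <= 4%:R * M.
Proof.
move=> hM.
apply: (@weighted_increments_le _ (a n x) (b x) (fun k => psi (iter k T x))) => //.
- move=> k; have [kn|nk] := ltnP k n.
    rewrite (aS _ _ _ kn); have /andP[a0 a1] := a01 n x k.+1.
    by have /andP[f0 f1] := f01' x k; rewrite ler_piMl.
  (* From [n] on the products defining [a] are empty, so both sides are 1. *)
  by rewrite /a !big_geq// leqW.
- move=> k; rewrite bS; have /andP[b0 b1] := b01 x k.
  by have /andP[g0 g1] := g01' x k; rewrite ler_piMr.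
Qed.

(** * Limits of weighted means and the upper bound *)

Definition weighted_mean n x psi : R :=
  n%:R^-1 * \sum_(0 <= k < n) weight n x k * psi (iter k T x).

Lemma weighted_meanD n x psi1 psi2 :
  weighted_mean n x (fun y => psi1 y + psi2 y) =
  weighted_mean n x psi1 + weighted_mean n x psi2.
Proof.
rewrite /weighted_mean -mulrDr -big_split/=; congr (_ * _).
by apply: eq_bigr => k _; rewrite mulrDr.
Qed.

Lemma weighted_meanZ n x r psi :
  weighted_mean n x (fun y => r * psi y) = r * weighted_mean n x psi.
Proof.
rewrite /weighted_mean [RHS]mulrCA; congr (_ * _); rewrite mulr_sumr.
by apply: eq_bigr => k _; rewrite mulrCA.
Qed.

Lemma weighted_mean_ge0 n x psi : (forall y, 0 <= psi y) ->
  0 <= weighted_mean n x psi.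
Proof.
move=> psi0; rewrite mulr_ge0 ?invr_ge0// sumr_ge0// => k _.
by rewrite mulr_ge0//; case/andP: (weight01 n x k).
Qed.

Lemma weighted_mean_le n x psi M : (forall y, `|psi y| <= M) ->
  `|weighted_mean n x psi| <= M.
Proof.
move=> hM; rewrite normrM ger0_norm ?invr_ge0//.
have M0 : 0 <= M := le_trans (normr_ge0 _) (hM point).
have [->|n0] := posnP n; first by rewrite invr0 mul0r.
rewrite mulrC ler_pdivrMr ?ltr0n// [leRHS]mulrC.
by apply: weighted_sum_le => // k; exact: hM.
Qed.

Lemma weighted_mean_small n x psi C :
  `|\sum_(0 <= k < n) weight n x k * psi (iter k T x)| <= C ->
  `|weighted_mean n x psi| <= n%:R^-1 * C.
Proof.
by move=> h; rewrite normrM ger0_norm ?invr_ge0// ler_wpM2l ?invr_ge0.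
Qed.

(** The mass [L (fun=> 1)] may be less than 1, even 0: the second clause makes [L] vanish along with
    its mass, and the third divides by the mass. The condition [k < m k] sends the lengths to
    infinity. *)
Lemma limit_of_weighted_means (m : nat -> nat) (x : nat -> X) (V : set_system nat) :
  UltraFilter V -> \oo `<=` V -> (forall k, (k < m k)%N) ->
  exists L : (X -> R) -> R, [/\
    forall psi, continuous psi ->
      weighted_mean (m k) (x k) psi @[k --> V] --> L psi,
    forall psi C, continuous psi -> (forall y, `|psi y| <= C) ->
      `|L psi| <= C * L (fun=> 1) &
    0 < L (fun=> 1) ->
    exists mu, [/\ invariant_measures T mu,
      integ mu (fun x => ln (f x)) = 0, integ mu (fun x => ln (g x)) = 0 &
      forall psi, continuous psi -> L psi = L (fun=> 1) * integ mu psi]].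
Proof.
move=> VV ooV km.
pose Lk k psi := weighted_mean (m k) (x k) psi.
pose L psi : R := lim (Lk k psi @[k --> V]).
have Lcvg psi : continuous psi -> Lk k psi @[k --> V] --> L psi.
  move=> cpsi; have [M M0 hM] := continuous_fun_bounded cX _ cpsi.
  apply: (@bounded_ultra_cvg _ _ _ (Lk ^~ psi) M) => k.
  exact: weighted_mean_le.
have Luniq psi l : continuous psi -> Lk k psi @[k --> V] --> l -> L psi = l.
  by move=> cpsi h; exact: cvg_lim h.
have c1 : continuous (fun _ : X => 1 : R) by exact: cst_continuous.
have cD (psi1 psi2 : X -> R) : continuous psi1 -> continuous psi2 ->
    continuous (fun y : X => psi1 y + psi2 y).
  by move=> ca cb y; apply: cvgD; [exact: ca|exact: cb].
have cZ r psi : continuous psi -> continuous (fun y : X => r * psi y).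
  by move=> ca y; apply: cvgM; [exact: cvg_cst|exact: ca].
have LD (psi1 psi2 : X -> R) : continuous psi1 -> continuous psi2 ->
    L (fun y => psi1 y + psi2 y) = L psi1 + L psi2.
  move=> ca cb; apply: Luniq; first exact: cD.
  rewrite (_ : (fun k => _) = fun k => Lk k psi1 + Lk k psi2); last first.
    by apply/funext => k; exact: weighted_meanD.
  by apply: cvgD; exact: Lcvg.
have LZ r psi : continuous psi -> L (fun y => r * psi y) = r * L psi.
  move=> ca; apply: Luniq; first exact: cZ.
  rewrite (_ : (fun k => _) = fun k => r * Lk k psi); last first.
    by apply/funext => k; exact: weighted_meanZ.
  by apply: cvgM; [exact: cvg_cst|exact: Lcvg].
have L_ge0 psi : continuous psi -> (forall y, 0 <= psi y) -> 0 <= L psi.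
  move=> ca psi0; apply: (limr_ge (cvgP _ (Lcvg _ ca))).
  by apply: nearW => k; exact: weighted_mean_ge0.
have L_le psi C : continuous psi -> (forall y, `|psi y| <= C) ->
    `|L psi| <= C * L (fun=> 1).
  move=> ca hC.
  (* Positivity of [C + r * psi], to be used for [r = 1] and [r = -1]. *)
  have le0 r : `|r| <= 1 -> 0 <= C * L (fun=> 1) + r * L psi.
    move=> r1; rewrite -!LZ// -LD; [|exact: cZ|exact: cZ].
    apply: L_ge0; first by apply: cD; exact: cZ.
    move=> y; rewrite mulr1 -lerBlDr sub0r.
    apply: (le_trans (ler_norm _)); rewrite normrN normrM -[leRHS]mul1r.
    by rewrite ler_pM.
  have := le0 1; have := le0 (-1); rewrite normrN normr1.
  move=> /(_ (lexx _)) h1 /(_ (lexx _)) h2.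
  by rewrite ler_norml; apply/andP; split; lra.
exists L; split => // q0.
(* Bounded weighted sums disappear after division by [m k >= k.+1]; the limit along [\oo] is also
   one along [V], which refines it. *)
have L_small psi C : continuous psi ->
    (forall k, `|\sum_(0 <= i < m k) weight (m k) (x k) i * psi (iter i T (x k))| <= C) ->
    L psi = 0.
  move=> ca hC; apply: Luniq => //.
  have h : Lk k psi @[k --> \oo] --> 0.
    apply/norm_cvg0P; apply: (@squeeze_cvgr _ _ _ _ (fun=> 0) (fun k => k.+1%:R^-1 * C)).
    - apply: nearW => k; rewrite normr_ge0/=.
      have C0 : 0 <= C := le_trans (normr_ge0 _) (hC k).
      apply: (le_trans (weighted_mean_small _ _ _ _ (hC k))).
      by rewrite ler_wpM2r// lef_pV2 ?posrE ?ltr0n ?ler_nat// (leq_trans _ (km k)).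
    - exact: cvg_cst.
    - rewrite -(mul0r C); apply: cvgM; last exact: cvg_cst.
      exact: cvg_harmonic.
  by move=> B /h; exact: ooV.
pose q := L (fun=> 1).
pose L' psi := q^-1 * L psi.
have qn0 : q != 0 by rewrite gt_eqF.
(* The arguments are additivity, homogeneity, positivity and normalisation of [L'], inherited from
   [L]. *)
have [mu muE imu] := @riesz_probability R X L' cX
  (fun a b ca cb => etrans (congr1 ( *%R q^-1) (LD a b ca cb)) (mulrDr _ _ _))
  (fun r a ca => etrans (congr1 ( *%R q^-1) (LZ r a ca)) (mulrCA _ _ _))
  (fun a ca a0 => mulr_ge0 (ltW (etrans (invr_gt0 _) q0)) (L_ge0 a ca a0))
  (mulVf qn0).
have cB (psi1 psi2 : X -> R) : continuous psi1 -> continuous psi2 ->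
    continuous (fun y : X => psi1 y - psi2 y).
  by move=> ca cb y; apply: cvgB; [exact: ca|exact: cb].
have muL psi : continuous psi -> L psi = q * integ mu psi.
  by move=> ca; rewrite imu// /L' mulVKf.
exists mu; split => //.
- apply: (@riesz_invariant _ _ T L') => // psi cpsi; rewrite /L'; congr (_ * _).
  have cpsiT : continuous (psi \o T).
    by move=> y; apply: continuous_comp; [exact: cT|exact: cpsi].
  have [M M0 hM] := continuous_fun_bounded cX _ cpsi.
  (* The coboundary [psi \o T - psi] has bounded weighted sums, so [L] kills it. *)
  have -> : psi \o T = fun y => psi y + (psi (T y) - psi y).
    by apply/funext => y /=; rewrite addrC subrK.
  rewrite LD//; last exact: cB.
  rewrite (L_small (fun y => psi (T y) - psi y) (4%:R * M)) ?addr0//.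
    exact: cB.
  by move=> k; apply: weight_coboundary.
- apply: integ_ln_eq0 => //; rewrite imu; last exact: cB.
  rewrite /L' (L_small _ 1) ?mulr0//; first exact: cB.
  by move=> k; exact: weight_one_sub_f.
- apply: integ_ln_eq0 => //; rewrite imu; last exact: cB.
  rewrite /L' (L_small _ 1) ?mulr0//; first exact: cB.
  by move=> k; exact: weight_one_sub_g.
Qed.

(** By contradiction: lengths [m k] at which the bound fails, with near-optimal points, give a limit
    [L] with [|L phi| >= s + e / 2]. But [L phi] is a mass at most 1 times an integral to which the
    hypothesis applies, so [|L phi| <= s]; zero mass would give [L phi = 0]. *)
Lemma growth_le (s e : R) : 0 <= s -> 0 < e ->
  (forall mu, invariant_measures T mu ->
    integ mu (fun x => ln (f x)) = 0 -> integ mu (fun x => ln (g x)) = 0 ->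
    `|integ mu phi| <= s) ->
  \forall n \near \oo, n%:R^-1 * K n <= s + e.
Proof.
move=> s0 e0 hs; apply: contrapT => H.
have {}H N : exists n, (N < n)%N /\ s + e < n%:R^-1 * K n.
  apply: contrapT => HN; apply: H; exists N.+1 => // n /= Nn.
  by rewrite leNgt; apply/negP => h; apply: HN; exists n.
have [m hm] := choice H.
have [x hx] := choice growth_le_offdiag.
have [V [VV ooV]] := ultraFilterLemma (_ : ProperFilter \oo).
have [L [Lcvg Lle Lmu]] :=
  limit_of_weighted_means m (x \o m) V VV ooV (fun k => (hm k).1).
have offE k : weighted_mean (m k) (x (m k)) phi =
    (m k)%:R^-1 * offdiag (m k) (x (m k)) by [].
have c1 : continuous (fun _ : X => 1 : R) by exact: cst_continuous.
have q01 : 0 <= L (fun=> 1) <= 1.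
  apply/andP; split.
    rewrite -(cvg_lim _ (Lcvg _ c1))//; apply: limr_ge; first exact: (cvgP _ (Lcvg _ c1)).
    by apply: nearW => k; exact: weighted_mean_ge0.
  rewrite -(cvg_lim _ (Lcvg _ c1))//; apply: limr_le; first exact: (cvgP _ (Lcvg _ c1)).
  apply: nearW => k; apply: (le_trans (ler_norm _)); apply: weighted_mean_le => y.
  by rewrite normr1.
(* Half of [e] absorbs the error [3 / m k] between the means of [K] and of [offdiag], since
   [m k > k]. *)
have big : s + e / 2%:R <= `|L phi|.
  rewrite leNgt; apply/negP => Lphi.
  have near1 : \forall k \near V,
      `|weighted_mean (m k) (x (m k)) phi| < s + e / 2%:R.
    exact: (cvgr_lt _ (cvg_norm (Lcvg _ cphi)) _ Lphi).
  have near2 : V [set k | 3%:R * k.+1%:R^-1 < e / 2%:R].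
    apply: ooV.
    have : 3%:R * k.+1%:R^-1 @[k --> \oo] --> (0 : R).
      by rewrite -(mulr0 3%:R); apply: cvgM; [exact: cvg_cst|exact: cvg_harmonic].
    by move=> h; apply: (cvgr_lt _ h); rewrite divr_gt0.
  have [k [/= h1 h2]] := filter_ex (filterI near1 near2).
  have [km hk] := hm k.
  move: h1; rewrite offE normrM ger0_norm ?invr_ge0// => h1.
  have h3 := hx (m k).
  have mk0 : 0 < (m k)%:R :> R by rewrite ltr0n (leq_ltn_trans (leq0n k)).
  have h4 : (m k)%:R^-1 * K (m k) <=
     (m k)%:R^-1 * `|offdiag (m k) (x (m k))| + (m k)%:R^-1 * 3%:R.
    by rewrite -mulrDr ler_wpM2l// invr_ge0 ltW.
  have h5 : (m k)%:R^-1 * 3%:R <= 3%:R * k.+1%:R^-1 :> R.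
    by rewrite mulrC ler_wpM2l// lef_pV2 ?posrE// ler_nat.
  have := lt_trans (lt_le_trans hk h4) (ltrD h1 (le_lt_trans h5 h2)).
  by rewrite -addrA -splitr ltxx.
have [C C0 hC] := continuous_fun_bounded cX _ cphi.
have Lphi := Lle _ _ cphi hC.
have /andP[q0 q1] := q01.
have q_gt0 : 0 < L (fun=> 1).
  rewrite lt_neqAle q0 andbT eq_sym; apply/eqP => q00.
  by move: Lphi; rewrite q00 mulr0; lra.
have [mu [imu lnf lng hmu]] := Lmu q_gt0.
have := hs mu imu lnf lng; move: big; rewrite hmu// normrM (ger0_norm q0) => big h.
have : L (fun=> 1) * `|integ mu phi| <= 1 * s by rewrite ler_pM.
by lra.
Qed.

Lemma growth_cvg (s : R) : 0 <= s ->
  (forall mu, invariant_measures T mu ->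
    integ mu (fun x => ln (f x)) = 0 -> integ mu (fun x => ln (g x)) = 0 ->
    `|integ mu phi| <= s) ->
  (forall n, (0 < n)%N -> s <= n%:R^-1 * K n) ->
  n%:R^-1 * K n @[n --> \oo] --> s.
Proof.
move=> s0 hs hK; apply/cvgrPdist_le => e e0.
have near1 := growth_le s e s0 e0 hs.
have near2 : \forall n \near \oo, (0 < n)%N by exists 1%N.
near=> n; have := hK n; have : n%:R^-1 * K n <= s + e by near: n.
have n0 : (0 < n)%N by near: n.
by move=> h1 /(_ n0) h2; rewrite distrC ger0_norm ?subr_ge0// lerBlDl.
Unshelve. all: by end_near. Qed.

End triangular_cocycle.

(** * Existence and value of the limit *)

Theorem theorem3p1 (R : realType) (X : pmetricType R) (T : X -> X)
    (f g phi : X -> R) :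
  compact [set: X] ->
  homeomorphism T ->
  continuous f -> continuous g -> continuous phi ->
  (forall x, 0 < f x <= 1) -> (forall x, 0 < g x <= 1) ->
  beta T (fun x => ln (f x)) = 0 ->
  beta T (fun x => ln (g x)) = 0 ->
  let S := Mmax T (fun x => ln (f x)) `&` Mmax T (fun x => ln (g x)) in
  let u := fun n : nat =>
    n%:R^-1 * sup [set opnorm2 (cocycle (Amat f g phi) T n x) | x in [set: X]] in
  (S !=set0 -> u @ \oo --> sup [set `|integ mu phi| | mu in S]) /\
  (S = set0 -> u @ \oo --> 0).
Proof.
move=> cX [cT _] cf cg cphi f01 g01 bf bg S u.
(* Since both maxima are 0, the common maximising measures are those for which both integrals
   vanish. *)
have SE mu : S mu <-> [/\ invariant_measures T mu,
    integ mu (fun x => ln (f x)) = 0 & integ mu (fun x => ln (g x)) = 0].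
  by rewrite /S /Mmax bf bg; split => [[[? ?] [? ?]]|[? ? ?]].
have growth_ge mu n : S mu -> n%:R * `|integ mu phi| <=
    sup [set opnorm2 (cocycle (Amat f g phi) T n x) | x in [set: X]].
  by move=> /SE[*]; exact: integ_le_growth.
split => [[mu0 Smu0]|S0].
- set s := sup _.
  (* The lower bound at [n = 1] bounds these integrals, so [s] is a true supremum. *)
  have ubs : has_ubound [set `|integ mu phi| | mu in S].
    exists (sup [set opnorm2 (cocycle (Amat f g phi) T 1 x) | x in [set: X]]).
    by move=> _ [mu Smu <-]; rewrite -[leLHS]mul1r; exact: (growth_ge mu 1%N).
  have les mu : S mu -> `|integ mu phi| <= s.
    by move=> Smu; apply: ub_le_sup => //; exists mu.
  apply: growth_cvg => //.
  + exact: le_trans (normr_ge0 _) (les _ Smu0).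
  + by move=> mu imu lnf lng; apply/les/SE.
  + move=> n n0; apply: ge_sup; first by exists `|integ mu0 phi|, mu0.
    move=> _ [mu Smu <-].
    by rewrite mulrC ler_pdivlMr ?ltr0n// mulrC; exact: growth_ge.
(* With [S] empty and limit 0, the bound on integrals is vacuous and the lower bound is
   nonnegativity of the growth. *)
- apply: growth_cvg => //.
  + move=> mu imu lnf lng; have : S mu by apply/SE.
    by rewrite S0.
  + move=> n n0; rewrite mulr_ge0 ?invr_ge0//.
    apply: (le_trans _ (@offdiag_le_growth R X T f g phi cX cphi f01 g01 n point)).
    exact: normr_ge0.
Qed.
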